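(* For all $q\in\mathbb{C}$ with $|q|<1$, $$I(q)=qF(q^3)+G(q^3).$$
   Context: $F$ and $G$ are the unique power series in $q$ with $F(0)=G(0)=1$ satisfying the system $F(q)=G(q^2)+qF(q^4)$ and $G(q)=qF(q^2)+G(q^4)$. $I$ is the unique power series in $q$ with $I(0)=1$ satisfying $I(q)=qI(q^2)+I(q^4)$ (it is the generating function of the Baum–Sweet sequence). All three series have coefficients in $\{0,1\}$, so they define analytic functions on the open unit disk. *)

(* Defs.v *)
From Stdlib Require Import Reals Arith Lia Lra.
From Coquelicot Require Import Coquelicot.

Set Implicit Arguments.

(* A formal power series in q with complex coefficients is its coefficient
   sequence [nat -> C].  [PS_plus] is the sum of series and [PS_incr_1] is
   multiplication by q. *)

(* Coefficients of a(q^k); only meaningful for k > 0. *)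
Definition PS_dilate (k : nat) (a : nat -> C) : nat -> C :=
  fun n => if (n mod k =? 0)%nat then a (n / k)%nat else RtoC 0.

(* F(q) = G(q^2) + q F(q^4)  and  G(q) = q F(q^2) + G(q^4). *)
Definition FG_system (f g : nat -> C) : Prop :=
  (f 0%nat = RtoC 1 /\ g 0%nat = RtoC 1) /\
  (forall n : nat,
     f n = PS_plus (PS_dilate 2 g) (PS_incr_1 (PS_dilate 4 f)) n) /\
  (forall n : nat,
     g n = PS_plus (PS_incr_1 (PS_dilate 2 f)) (PS_dilate 4 g) n).

(* I(q) = q I(q^2) + I(q^4). *)
Definition Baum_Sweet_eq (b : nat -> C) : Prop :=
  b 0%nat = RtoC 1 /\
  (forall n : nat,
     b n = PS_plus (PS_incr_1 (PS_dilate 2 b)) (PS_dilate 4 b) n).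

(* Complex analogue of [PSeries]: the sum of the series a at z.  It is an
   arbitrary value where the series diverges; see [CPSeries_correct]. *)
Definition CPSeries (a : nat -> C) (z : C) : C :=
  @iota (CompleteNormedModule.CompleteSpace _ C_CompleteNormedModule)
    (is_pseries a z).

Lemma CPSeries_correct (a : nat -> C) (z : C) :
  ex_pseries a z -> is_pseries a z (CPSeries a z).
Proof.
intros [l Hl].
apply (@iota_correct _ C_CompleteNormedModule (is_pseries a z)); exists l; split; [exact Hl|].
intros l' Hl'.
exact (@filterlim_locally_unique _ _ C_NormedModule _ _ _ _ _ Hl Hl').
Qed.

Lemma causal_fixpoint (A : Type) (x0 : A) (T : (nat -> A) -> nat -> A) :
  (forall u v n, (forall m, (m < n)%nat -> u m = v m) -> T u n = T v n) ->
  exists u : nat -> A, forall n, u n = T u n.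
Proof.
intros HT.
pose (it := fix it k := match k with 0%nat => fun _ => x0
                                   | S k => T (it k) end).
assert (Hit : forall n k, (n < k)%nat -> it k n = it (S n) n).
{ induction n as [n IH] using lt_wf_ind.
  intros [|k] Hk; [lia|].
  simpl; apply HT; intros m Hm.
  rewrite (IH m Hm k) by lia.
  symmetry; apply IH; lia. }
exists (fun n => it (S n) n); intros n.
change (it (S n) n) with (T (it n) n).
apply HT; intros m Hm; apply Hit; exact Hm.
Qed.

Lemma PS_dilate_ext (k : nat) (u v : nat -> C) (n p : nat) :
  (2 <= k)%nat -> (n <= p)%nat -> (0 < p)%nat ->
  (forall m, (m < p)%nat -> u m = v m) -> PS_dilate k u n = PS_dilate k v n.
Proof.
intros Hk Hn Hp H; unfold PS_dilate.
destruct (n mod k =? 0)%nat; [|reflexivity].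
apply H.
destruct n as [|n]; [rewrite Nat.Div0.div_0_l; lia|].
apply Nat.lt_le_trans with (S n); [apply Nat.div_lt; lia|lia].
Qed.

Lemma PS_incr_dilate_ext (k : nat) (u v : nat -> C) (n : nat) :
  (2 <= k)%nat -> (forall m, (m < n)%nat -> u m = v m) ->
  PS_incr_1 (PS_dilate k u) n = PS_incr_1 (PS_dilate k v) n.
Proof.
intros Hk H; destruct n as [|n]; [reflexivity|].
simpl; apply PS_dilate_ext with (S n); auto; lia.
Qed.

Lemma FG_system_exists : exists f g : nat -> C, FG_system f g.
Proof.
pose (T := fun (u : nat -> C * C) (n : nat) =>
  let f m := fst (u m) in let g m := snd (u m) in
  match n with
  | 0%nat => (RtoC 1, RtoC 1)
  | S _ => (PS_plus (PS_dilate 2 g) (PS_incr_1 (PS_dilate 4 f)) n,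
            PS_plus (PS_incr_1 (PS_dilate 2 f)) (PS_dilate 4 g) n)
  end).
destruct (@causal_fixpoint (C * C) (RtoC 1, RtoC 1) T) as [u Hu].
{ intros u v n H; unfold T; destruct n as [|n]; [reflexivity|].
  assert (Hf : forall m, (m < S n)%nat -> fst (u m) = fst (v m))
    by (intros; rewrite H; auto).
  assert (Hg : forall m, (m < S n)%nat -> snd (u m) = snd (v m))
    by (intros; rewrite H; auto).
  unfold PS_plus; f_equal; f_equal.
  - apply PS_dilate_ext with (S n); auto; lia.
  - apply PS_incr_dilate_ext; auto; lia.
  - apply PS_incr_dilate_ext; auto; lia.
  - apply PS_dilate_ext with (S n); auto; lia. }
assert (H0 : u 0%nat = (RtoC 1, RtoC 1)) by apply Hu.
exists (fun n => fst (u n)), (fun n => snd (u n)).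
split; [split; rewrite H0; reflexivity|split].
- intros [|n].
  + unfold PS_plus, PS_dilate, PS_incr_1; simpl; rewrite H0; simpl.
    rewrite plus_zero_r; reflexivity.
  + pattern (u (S n)) at 1; rewrite Hu; reflexivity.
- intros [|n].
  + unfold PS_plus, PS_dilate, PS_incr_1; simpl; rewrite H0; simpl.
    rewrite plus_zero_l; reflexivity.
  + pattern (u (S n)) at 1; rewrite Hu; reflexivity.
Qed.

Lemma FG_system_unique (f g f' g' : nat -> C) :
  FG_system f g -> FG_system f' g' ->
  forall n : nat, f n = f' n /\ g n = g' n.
Proof.
intros [[f0 g0] [Hf Hg]] [[f0' g0'] [Hf' Hg']].
induction n as [n IH] using lt_wf_ind.
destruct n as [|n]; [split; congruence|].
assert (IHf : forall m, (m < S n)%nat -> f m = f' m) by (intros; now apply IH).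
assert (IHg : forall m, (m < S n)%nat -> g m = g' m) by (intros; now apply IH).
rewrite Hf, Hg, Hf', Hg'; unfold PS_plus; split; f_equal.
- apply PS_dilate_ext with (S n); auto; lia.
- apply PS_incr_dilate_ext; auto; lia.
- apply PS_incr_dilate_ext; auto; lia.
- apply PS_dilate_ext with (S n); auto; lia.
Qed.

Lemma Baum_Sweet_eq_exists : exists b : nat -> C, Baum_Sweet_eq b.
Proof.
pose (T := fun (b : nat -> C) (n : nat) =>
  match n with
  | 0%nat => RtoC 1
  | S _ => PS_plus (PS_incr_1 (PS_dilate 2 b)) (PS_dilate 4 b) n : C
  end).
destruct (@causal_fixpoint C (RtoC 1) T) as [b Hb].
{ intros u v n H; unfold T; destruct n as [|n]; [reflexivity|].
  unfold PS_plus; f_equal.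
  - apply PS_incr_dilate_ext; auto; lia.
  - apply PS_dilate_ext with (S n); auto; lia. }
assert (H0 : b 0%nat = RtoC 1) by apply Hb.
exists b; split; [exact H0|].
intros [|n].
- unfold PS_plus, PS_dilate, PS_incr_1; simpl; rewrite H0.
  rewrite plus_zero_l; reflexivity.
- rewrite Hb at 1; reflexivity.
Qed.

Lemma Baum_Sweet_eq_unique (b b' : nat -> C) :
  Baum_Sweet_eq b -> Baum_Sweet_eq b' -> forall n : nat, b n = b' n.
Proof.
intros [b0 Hb] [b0' Hb'].
induction n as [n IH] using lt_wf_ind.
destruct n as [|n]; [congruence|].
rewrite Hb, Hb'; unfold PS_plus; f_equal.
- apply PS_incr_dilate_ext; auto; lia.
- apply PS_dilate_ext with (S n); auto; lia.
Qed.

Definition coef01 (a : nat -> C) : Prop :=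
  forall n : nat, a n = RtoC 0 \/ a n = RtoC 1.

(* q A(q^k) has only odd exponents and B(q^l) only even ones, so at most one
   summand is nonzero. *)
Lemma PS_incr_dilate_plus_01 (k l : nat) (u v : nat -> C) (n : nat) :
  (k = 2 \/ k = 4)%nat -> (l = 2 \/ l = 4)%nat ->
  (forall m, (m <= n)%nat -> u m = RtoC 0 \/ u m = RtoC 1) ->
  (forall m, (m <= n)%nat -> v m = RtoC 0 \/ v m = RtoC 1) ->
  let w := Cplus (PS_dilate k u n) (PS_dilate l v (S n)) in
  w = RtoC 0 \/ w = RtoC 1.
Proof.
intros Hk Hl Hu Hv w; unfold w, PS_dilate.
assert (Hun : u (n / k)%nat = RtoC 0 \/ u (n / k)%nat = RtoC 1).
{ apply Hu; apply Nat.Div0.div_le_upper_bound; destruct Hk; subst; lia. }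
assert (Hvn : v (S n / l)%nat = RtoC 0 \/ v (S n / l)%nat = RtoC 1).
{ apply Hv; apply Nat.lt_succ_r; apply Nat.div_lt; lia. }
destruct (n mod k =? 0)%nat eqn:E1; destruct (S n mod l =? 0)%nat eqn:E2;
  rewrite ?Cplus_0_l, ?Cplus_0_r; auto.
exfalso.
apply Nat.eqb_eq in E1, E2.
apply Nat.Div0.mod_divides in E1; apply Nat.Div0.mod_divides in E2.
destruct E1, E2, Hk, Hl; subst; lia.
Qed.

Lemma FG_system_01 (f g : nat -> C) :
  FG_system f g -> coef01 f /\ coef01 g.
Proof.
intros [[f0 g0] [Hf Hg]].
assert (H : forall n, (f n = RtoC 0 \/ f n = RtoC 1) /\
                      (g n = RtoC 0 \/ g n = RtoC 1)).
{ induction n as [n IH] using lt_wf_ind.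
  destruct n as [|n]; [auto|].
  rewrite Hf, Hg; unfold PS_plus, PS_incr_1.
  assert (IHf : forall m, (m <= n)%nat -> f m = RtoC 0 \/ f m = RtoC 1)
    by (intros; apply IH; lia).
  assert (IHg : forall m, (m <= n)%nat -> g m = RtoC 0 \/ g m = RtoC 1)
    by (intros; apply IH; lia).
  split.
  - rewrite plus_comm; apply PS_incr_dilate_plus_01; auto.
  - apply PS_incr_dilate_plus_01; auto. }
split; intros n; apply H.
Qed.

Lemma Baum_Sweet_eq_01 (b : nat -> C) : Baum_Sweet_eq b -> coef01 b.
Proof.
intros [b0 Hb] n.
induction n as [n IH] using lt_wf_ind.
destruct n as [|n]; [auto|].
rewrite Hb; apply PS_incr_dilate_plus_01; auto; intros; apply IH; lia.
Qed.

Lemma coef01_ex_pseries (a : nat -> C) (z : C) :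
  coef01 a -> (Cmod z < 1)%R -> ex_pseries a z.
Proof.
intros Ha Hz.
apply (@ex_series_le C_AbsRing C_CompleteNormedModule _
         (fun n => (Cmod z ^ n)%R)).
- intros n.
  change (Cmod (Cmult (pow_n (z : C_Ring) n) (a n)) <= Cmod z ^ n)%R.
  rewrite Cmod_mult.
  assert (E : Cmod (pow_n (z : C_Ring) n) = (Cmod z ^ n)%R).
  { induction n as [|n IH]; simpl; [apply Cmod_1|].
    change (Cmod (Cmult z (pow_n (z : C_Ring) n)) = (Cmod z * Cmod z ^ n)%R).
    rewrite Cmod_mult, IH; reflexivity. }
  rewrite E.
  assert (0 <= Cmod z ^ n)%R by (apply pow_le, Cmod_ge_0).
  destruct (Ha n) as [-> | ->]; rewrite ?Cmod_0, ?Cmod_1; lra.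
- apply ex_series_geom; rewrite Rabs_pos_eq; [exact Hz|apply Cmod_ge_0].
Qed.

(* Main.v *)
Require Import Defs.
From Stdlib Require Import Reals Arith Lia FunctionalExtensionality.
From Coquelicot Require Import Coquelicot.

(** Put H(q) = q F(q^3) + G(q^3).  Substituting q^2 and q^4 for q,
      q H(q^2) + H(q^4) = q^3 F(q^6) + q G(q^6) + q^4 F(q^12) + G(q^12)
                        = q (G(q^6) + q^3 F(q^12)) + (q^3 F(q^6) + G(q^12)),
    and the two parentheses are F(q^3) and G(q^3) by the defining system taken
    at q^3.  So H solves the equation that defines I, with the same constant term
    ([Baum_Sweet_eq_of_FG_system]); since that equation determines every
    coefficient from the earlier ones, H = I as formal series.

    The computation is carried out on coefficient sequences, where it needs only
    that q |-> q^k is a ring endomorphism of power series, applied to sums, to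
    products with q and to other dilations.  The identity between functions
    follows because evaluation commutes with these operations; for dilation
    this is [is_pseries_dilate]. *)

Lemma PS_dilate_plus (k : nat) (u v : nat -> C) :
  PS_dilate k (PS_plus u v) = PS_plus (PS_dilate k u) (PS_dilate k v).
Proof.
apply functional_extensionality; intros n.
unfold PS_plus, PS_dilate.
destruct (n mod k =? 0)%nat; [reflexivity|].
symmetry; apply (plus_zero_l (G := C_AbelianMonoid)).
Qed.

Lemma PS_incr_1_plus (u v : nat -> C) :
  PS_incr_1 (PS_plus u v) = PS_plus (PS_incr_1 u) (PS_incr_1 v).
Proof.
apply functional_extensionality; intros [|n]; unfold PS_plus; simpl.
- symmetry; apply plus_zero_l.
- reflexivity.
Qed.

Lemma PS_dilate_mul (k : nat) (a : nat -> C) (m : nat) :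
  (0 < k)%nat -> PS_dilate k a (k * m) = a m.
Proof.
intros Hk; unfold PS_dilate.
rewrite Nat.mul_comm, Nat.Div0.mod_mul, Nat.div_mul by lia; reflexivity.
Qed.

Lemma PS_dilate_mul_add (k : nat) (a : nat -> C) (m r : nat) :
  (0 < r < k)%nat -> PS_dilate k a (k * m + r) = RtoC 0.
Proof.
intros Hr; unfold PS_dilate.
replace ((k * m + r) mod k)%nat with r
  by (apply Nat.mod_unique with m; lia).
destruct r; [lia|reflexivity].
Qed.

Lemma PS_dilate_dilate (k l : nat) (a : nat -> C) :
  (0 < k)%nat -> (0 < l)%nat ->
  PS_dilate k (PS_dilate l a) = PS_dilate (k * l) a.
Proof.
intros Hk Hl; apply functional_extensionality; intros n.
unfold PS_dilate.
(* n mod kl = n mod k + k ((n / k) mod l) vanishes iff both summands do. *)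
rewrite Nat.Div0.mod_mul_r, Nat.Div0.div_div.
destruct (Nat.eqb_spec (n mod k) 0) as [E1|E1];
  destruct (Nat.eqb_spec ((n / k) mod l) 0) as [E2|E2];
  destruct (Nat.eqb_spec (n mod k + k * ((n / k) mod l)) 0);
  try reflexivity; exfalso; nia.
Qed.

(** The substitution q |-> q^k also acts on the factor q, hence the shift by k. *)
Lemma PS_dilate_incr_1 (k : nat) (a : nat -> C) :
  (0 < k)%nat ->
  PS_dilate k (PS_incr_1 a) = PS_incr_n (PS_dilate k a) k.
Proof.
intros Hk; apply functional_extensionality; intros n.
rewrite PS_incr_n_simplify.
rewrite (Nat.div_mod_eq n k).
assert (Hr : (n mod k < k)%nat) by (apply Nat.mod_upper_bound; lia).
generalize dependent (n mod k)%nat; generalize (n / k)%nat; intros m r Hr.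
destruct r as [|r].
- rewrite Nat.add_0_r, PS_dilate_mul by lia.
  destruct m as [|m]; destruct (le_lt_dec _ _); try nia; [reflexivity|].
  replace (k * S m - k)%nat with (k * m)%nat by nia.
  rewrite PS_dilate_mul by lia; reflexivity.
- rewrite PS_dilate_mul_add by lia.
  destruct (le_lt_dec _ _); [|reflexivity].
  destruct m as [|m]; [lia|].
  replace (k * S m + S r - k)%nat with (k * m + S r)%nat by nia.
  rewrite PS_dilate_mul_add by lia; reflexivity.
Qed.

Lemma Baum_Sweet_eq_of_FG_system (f g : nat -> C) :
  FG_system f g ->
  Baum_Sweet_eq (PS_plus (PS_incr_1 (PS_dilate 3 f)) (PS_dilate 3 g)).
Proof.
intros [[f0 g0] [Hf Hg]].
apply functional_extensionality in Hf, Hg.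
split.
- unfold PS_plus, PS_dilate; simpl; rewrite g0; apply plus_zero_l.
- intros n.
  assert (H3f : PS_dilate 3 f = PS_plus (PS_dilate 6 g)
                  (PS_incr_n (PS_dilate 12 f) 3)).
  { rewrite Hf at 1.
    rewrite PS_dilate_plus, PS_dilate_incr_1, !PS_dilate_dilate by lia.
    reflexivity. }
  assert (H3g : PS_dilate 3 g = PS_plus (PS_incr_n (PS_dilate 6 f) 3)
                  (PS_dilate 12 g)).
  { rewrite Hg at 1.
    rewrite PS_dilate_plus, PS_dilate_incr_1, !PS_dilate_dilate by lia.
    reflexivity. }
  rewrite !PS_dilate_plus, !PS_dilate_incr_1, !PS_dilate_dilate by lia.
  rewrite H3f, H3g.
  rewrite !PS_incr_1_plus.
  change (2 * 3)%nat with 6%nat; change (4 * 3)%nat with 12%nat.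
  change (PS_incr_1 (PS_incr_n (PS_dilate 12 f) 3))
    with (PS_incr_n (PS_dilate 12 f) 4).
  change (PS_incr_1 (PS_incr_n (PS_dilate 6 f) 2))
    with (PS_incr_n (PS_dilate 6 f) 3).
  unfold PS_plus.
  change (@plus _) with Cplus; ring.
Qed.

Lemma CPSeries_unique (a : nat -> C) (z l : C) :
  is_pseries a z l -> CPSeries a z = l.
Proof.
intros Hl.
assert (H : is_pseries a z (CPSeries a z))
  by (apply CPSeries_correct; exists l; exact Hl).
exact (@filterlim_locally_unique _ _ C_NormedModule _ _ _ _ _ H Hl).
Qed.

(** The only nonzero terms of a(q^k) with index at most n are those at the
    multiples k j with j <= n / k. *)
Lemma sum_n_dilate (k : nat) (a : nat -> C) (z : C) (n : nat) :
  (0 < k)%nat ->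
  sum_n (fun i => scal (pow_n (z : C_Ring) i) (PS_dilate k a i)) n
  = sum_n (fun i => scal (pow_n ((z ^ k)%C : C_Ring) i) (a i)) (n / k).
Proof.
intros Hk; induction n as [|n IH].
- rewrite Nat.Div0.div_0_l, !sum_O.
  unfold PS_dilate; rewrite Nat.Div0.mod_0_l, Nat.Div0.div_0_l; reflexivity.
- rewrite sum_Sn, IH.
  assert (Hr : (n mod k < k)%nat) by (apply Nat.mod_upper_bound; lia).
  assert (Hn := Nat.div_mod_eq n k).
  destruct (Nat.eq_dec (S (n mod k)) k) as [E|E].
  + assert (Hs : S n = (k * S (n / k))%nat) by nia.
    replace (S n / k)%nat with (S (n / k))
      by (apply Nat.div_unique with 0%nat; lia).
    rewrite sum_Sn, Hs, PS_dilate_mul by lia.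
    do 2 f_equal; exact (Cpow_mult_r z k (S (n / k))).
  + replace (S n / k)%nat with (n / k)%nat
      by (apply Nat.div_unique with (S (n mod k)); lia).
    replace (S n) with (k * (n / k) + S (n mod k))%nat by lia.
    rewrite PS_dilate_mul_add by lia.
    rewrite (scal_zero_r (V := C_ModuleSpace)); apply plus_zero_r.
Qed.

(** Each partial sum of a(z^k) is repeated k times, and n / k tends to infinity
    with n. *)
Lemma is_pseries_dilate (k : nat) (a : nat -> C) (z l : C) :
  (0 < k)%nat -> is_pseries a (z ^ k)%C l -> is_pseries (PS_dilate k a) z l.
Proof.
intros Hk H.
unfold is_pseries, is_series.
apply filterlim_ext with
  (fun n => sum_n (fun i => scal (pow_n ((z ^ k)%C : C_Ring) i) (a i)) (n / k)).
{ intros n; symmetry; apply sum_n_dilate; exact Hk. }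
apply (filterlim_comp _ _ _ (fun n => n / k)%nat) with (2 := H).
intros P [N HN]; exists (k * N)%nat; intros n Hn.
apply HN, Nat.div_le_lower_bound; lia.
Qed.

Theorem proposition1p1p8 :
  forall (f g b : nat -> C),
    FG_system f g ->
    Baum_Sweet_eq b ->
    forall q : C, (Cmod q < 1)%R ->
      CPSeries b q
      = (q * CPSeries f (q ^ 3)%C + CPSeries g (q ^ 3)%C)%C.
Proof.
intros f g b Hfg Hb q Hq.
replace b with (PS_plus (PS_incr_1 (PS_dilate 3 f)) (PS_dilate 3 g))
  by (apply functional_extensionality, Baum_Sweet_eq_unique;
      auto using Baum_Sweet_eq_of_FG_system).
assert (Hq3 : (Cmod (q ^ 3)%C < 1)%R).
{ rewrite Cmod_pow.
  apply pow_lt_1_compat; [split; [apply Cmod_ge_0|exact Hq]|lia]. }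
destruct (FG_system_01 Hfg) as [Hf Hg].
apply CPSeries_unique.
apply (is_pseries_plus (V := C_NormedModule)).
- apply (is_pseries_incr_1 (V := C_NormedModule)).
  apply is_pseries_dilate; [lia|].
  apply CPSeries_correct, coef01_ex_pseries; assumption.
- apply is_pseries_dilate; [lia|].
  apply CPSeries_correct, coef01_ex_pseries; assumption.
Qed.
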